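(* Let $q$ be a prime power, $v\ge 1$, and let $G< P\Gamma L(v,q)$ be a group acting transitively on the set ${\mathbb{F}_q^v \brack 1}$ of $1$-dimensional subspaces of $\mathbb{F}_q^v$. Let $\alpha$ be a $1$-dimensional subspace of $\mathbb{F}_q^v$ and let $P=G_\alpha$ be its stabilizer in $G$. Let $\Delta=\bigcup_{i=1}^s \delta_i P$, where $\delta_1=\alpha$ and $\delta_1,\ldots,\delta_s$ are representatives of distinct $P$-orbits on ${\mathbb{F}_q^v \brack 1}$. Suppose that $\Delta$ is a subspace of $\mathbb{F}_q^v$ (i.e. $\Delta$ is exactly the set of all $1$-dimensional subspaces of some subspace of $\mathbb{F}_q^v$, which we identify with $\Delta$). Let $\mathcal{B}=\{\Delta g \mid g\in G\}$ (the set of blocks of the $q$-analog of a $1$-design with base block $\Delta$). If $$\{\alpha g : g\in G,\ \alpha g^{-1}\in \Delta\}=\Delta,$$ then $\mathcal{B}$ is the set of neighborhoods of a $(\dim\Delta-1)$-regular $q$-ary graph $\mathcal{E}$ in $\mathbb{F}_q^v$, and $\mathcal{B}'=\{(\alpha g,\Delta g)\mid g\in G\}$ is the set of ordered pairs $(x,N_{\mathcal{E}}(x))$, $x\in {\mathbb{F}_q^v \brack 1}$. Moreover, $G$ acts as an automorphism group of $\mathcal{E}$, transitively on the $1$-dimensional subspaces of $\mathbb{F}_q^v$ and on the set of neighborhoods of $\mathcal{E}$.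
   Context: Groups act on the right: $xg$ denotes the image of $x$ under $g$, and for a set $X$ of subspaces $Xg=\{xg: x\in X\}$. $P\Gamma L(v,q)=\Gamma L(v,q)/C$ with $C$ the scalar maps; it acts faithfully on subspaces of $\mathbb{F}_q^v$. ${\mathbb{F}_q^v \brack k}$ denotes the set of $k$-dimensional subspaces of $\mathbb{F}_q^v$. A $q$-ary graph $\mathcal{E}$ in $\mathbb{F}_q^v$ is a pair $(V,E)$ with $V={\mathbb{F}_q^v \brack 1}$ (vertices) and $E\subseteq {\mathbb{F}_q^v \brack 2}$ (edges); vertices $x\neq y$ are adjacent if $x\oplus y\in E$. The neighborhood $N_{\mathcal{E}}(x)$ of a vertex $x$ is the set consisting of $x$ and all vertices adjacent to $x$. $\mathcal{E}$ is $k$-regular if for every vertex $x$, $N_{\mathcal{E}}(x)$ is (the set of $1$-subspaces of) a $(k+1)$-dimensional subspace. An automorphism of $\mathcal{E}$ is an element of $P\Gamma L(v,q)$ mapping edges to edges; an automorphism group is a group of such maps. *)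

(* Defs.v *)
From HB Require Import structures.
From mathcomp Require Import all_boot all_fingroup all_algebra all_solvable.
From mathcomp Require Import all_field.

Set Implicit Arguments.
Unset Strict Implicit.
Unset Printing Implicit Defensive.

Import GRing.Theory.
Local Open Scope ring_scope.

Section FiniteSubspaces.
Import VectorInternalTheory.
Variables (F : finFieldType) (vT : vectType F).
HB.instance Definition _ := [Countable of {vspace vT} by <:].
HB.instance Definition _ := [Finite of {vspace vT} by <:].
End FiniteSubspaces.

Section Semilinear.
Variables (F : finFieldType) (v : nat).
Local Notation V := 'rV[F]_v.
Implicit Types (f g : {perm V}) (U : {vspace V}) (s t : {perm F}).

Definition field_aut s : bool :=
  [&& s 1 == 1,
      [forall a, forall b, s (a + b) == s a + s b]
    & [forall a, forall b, s (a * b) == s a * s b]].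

Lemma field_autP s :
  reflect [/\ s 1 = 1, {morph s : a b / a + b} & {morph s : a b / a * b}]
          (field_aut s).
Proof.
apply: (iffP and3P) => -[s1 sD sM]; split; first exact/eqP.
- by move=> a b; move/forallP/(_ a)/forallP/(_ b)/eqP: sD.
- by move=> a b; move/forallP/(_ a)/forallP/(_ b)/eqP: sM.
- by rewrite s1.
- by apply/forallP=> a; apply/forallP=> b; rewrite sD.
- by apply/forallP=> a; apply/forallP=> b; rewrite sM.
Qed.

Definition semilinear f : bool :=
  [exists s : {perm F}, [&& field_aut s,
      [forall u, forall w, f (u + w) == f u + f w]
    & [forall a, forall u, f (a *: u) == s a *: f u]]].

Lemma semilinearP f :
  reflect (exists s : {perm F}, [/\ field_aut s, {morph f : u w / u + w}
                                  & forall a u, f (a *: u) = s a *: f u])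
          (semilinear f).
Proof.
apply: (iffP existsP) => -[s] => [/and3P[sA fD sf]|[sA fD sf]]; exists s.
  split=> // [u w|a u]; first by move/forallP/(_ u)/forallP/(_ w)/eqP: fD.
  by move/forallP/(_ a)/forallP/(_ u)/eqP: sf.
apply/and3P; split=> //; first by do 2!apply/forallP=> ?; rewrite fD.
by do 2!apply/forallP=> ?; rewrite sf.
Qed.

(* Products of permutations compose from left to right, so groups act on the
   right throughout. *)
Definition GammaL_set : {set {perm V}} := [set f | semilinear f].

Lemma GammaL_group_set : group_set GammaL_set.
Proof.
apply/group_setP; split=> [|f g].
  rewrite inE; apply/semilinearP; exists 1%g; split=> [|u w|a u]; rewrite ?perm1 //.
  by apply/field_autP; split=> [|a b|a b]; rewrite !perm1.
rewrite !inE => /semilinearP[s [/field_autP[s1 sD sM] fD sf]].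
case/semilinearP=> t [/field_autP[t1 tD tM] gD tg].
apply/semilinearP; exists (s * t)%g; split=> [|u w|a u].
- by apply/field_autP; split=> [|a b|a b]; rewrite !permM ?s1 ?sD ?sM.
- by rewrite !permM fD gD.
- by rewrite !permM sf tg.
Qed.

Canonical GammaL : {group {perm V}} := Group GammaL_group_set.

Lemma GammaLP f :
  reflect (exists s : {perm F}, [/\ field_aut s, {morph f : u w / u + w}
                                  & forall a u, f (a *: u) = s a *: f u])
          (f \in GammaL).
Proof. by rewrite inE; apply: semilinearP. Qed.

Definition scalars_set : {set {perm V}} :=
  [set f : {perm V} | [exists a : F, (a != 0) && [forall u, f u == a *: u]]].

Lemma scalarsP f :
  reflect (exists2 a : F, a != 0 & forall u, f u = a *: u) (f \in scalars_set).
Proof.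
rewrite inE; apply: (iffP existsP) => -[a].
  by case/andP=> a0 /forallP fa; exists a => // u; apply/eqP.
by move=> a0 fa; exists a; rewrite a0; apply/forallP=> u; rewrite fa.
Qed.

Lemma scalars_group_set : group_set scalars_set.
Proof.
apply/group_setP; split=> [|f g].
  by apply/scalarsP; exists 1 => [|u]; rewrite ?oner_eq0 // perm1 scale1r.
case/scalarsP=> a a0 fa /scalarsP[b b0 gb]; apply/scalarsP.
by exists (b * a) => [|u]; rewrite ?mulf_neq0 // permM fa gb scalerA.
Qed.

Canonical scalars : {group {perm V}} := Group scalars_group_set.

Lemma scalars_sub : scalars \subset GammaL.
Proof.
apply/subsetP=> f /scalarsP[a a0 fa]; apply/GammaLP; exists 1%g; split.
- by apply/field_autP; split=> [|b c|b c]; rewrite !perm1.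
- by move=> u w; rewrite !fa scalerDr.
- by move=> b u; rewrite perm1 !fa !scalerA mulrC.
Qed.

Lemma scalars_normal : (scalars <| GammaL)%g.
Proof.
rewrite /normal scalars_sub; apply/subsetP=> f /GammaLP[s [sA fD sf]].
rewrite inE; apply/subsetP=> _ /imsetP[g /scalarsP[a a0 ga] ->].
have [s1 _ sM] := field_autP _ sA; apply/scalarsP; exists (s a) => [|u].
  apply: contra_neq (oner_neq0 F) => sa0.
  by rewrite -s1 -(divff a0) sM sa0 mul0r.
by rewrite conjgE !permM ga sf permKV.
Qed.

Definition PGammaL : {set coset_of scalars} := (GammaL / scalars)%g.

(* For semilinear f this is the image of U (lemma mem_subspace_img).  The value
   elsewhere is irrelevant: an action must merely be injective there. *)
Definition subspace_img U f : {vspace V} :=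
  if f \in GammaL then <<[seq f u | u in U]>>%VS else U.

Lemma mem_subspace_img U f u :
  f \in GammaL -> (f u \in subspace_img U f) = (u \in U).
Proof.
move=> fG; rewrite /subspace_img fG; apply/idP/idP=> [|uU]; last first.
  by apply: memv_span; apply/imageP; exists u.
have [t [tA gD tg]] := GammaLP _ (groupVr fG).
rewrite -[image_mem _ _]/(val (in_tuple _)) => /coord_span fu.
rewrite -[u](permK f) {}fu.
have t0 : f^-1%g 0 = 0 by apply: (addrI (f^-1%g 0)); rewrite -gD !addr0.
elim/big_rec: _ => [|i w _ wU]; first by rewrite t0 mem0v.
rewrite gD tg memvD ?memvZ //.
have lt_i : (i < size [seq f w0 | w0 in U])%N by case: i.
case/imageP: (mem_nth 0 lt_i) => w' w'U ->.
by rewrite permK.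
Qed.

Lemma subspace_img_is_action : is_action GammaL subspace_img.
Proof.
split=> [f U W|U f g fG gG].
  case fG: (f \in GammaL); last by rewrite /subspace_img fG.
  move=> eqUW; apply/vspaceP=> u.
  by rewrite -(mem_subspace_img U _ fG) eqUW mem_subspace_img.
apply/vspaceP=> w; rewrite -[w](permKV (f * g)%g); move: (_ w) => u.
by rewrite mem_subspace_img ?groupM // permM 2?mem_subspace_img.
Qed.

Canonical subspace_action := Action subspace_img_is_action.

Lemma scalars_fix U : U \in 'Fix_subspace_action(scalars)%g.
Proof.
apply/afixP=> f fC; have fG := subsetP scalars_sub _ fC; apply/vspaceP=> w.
rewrite -[w in LHS](permKV f) mem_subspace_img // -[w in RHS](permKV f).
by case/scalarsP: fC => a a0 ->; rewrite rpredZeq (negPf a0).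
Qed.

(* By modactE, a coset acts through any of its representatives on the subspaces
   fixed by all scalar maps, i.e. on all of them (lemmas scalars_fix and
   PGammaL_actionE). *)
Definition PGammaL_action := (subspace_action %% scalars)%act.

Lemma PGammaL_actionE U f :
  f \in GammaL -> PGammaL_action U (coset scalars f) = subspace_img U f.
Proof.
move=> fG; rewrite [LHS]modactE //; last first.
  by rewrite (setIidPr scalars_sub) scalars_fix.
by apply: (subsetP (normal_norm scalars_normal)).
Qed.

Definition subspaces (k : nat) : {set {vspace V}} := [set U | \dim U == k].

Definition points U : {set {vspace V}} := [set x in subspaces 1 | (x <= U)%VS].

(* The vertex set of a q-ary graph is always subspaces 1. *)
Record qgraph := QGraph {
  edges : {set {vspace V}};
  edges_dim : edges \subset subspaces 2
}.
Implicit Type E : qgraph.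

Definition adjacent E (x y : {vspace V}) : bool :=
  (x != y) && ((x + y)%VS \in edges E).

Definition neighborhood E (x : {vspace V}) : {set {vspace V}} :=
  [set y in subspaces 1 | (y == x) || adjacent E x y].

Definition regular E (k : nat) : Prop :=
  forall x, x \in subspaces 1 ->
    exists2 U : {vspace V}, \dim U = k.+1 & neighborhood E x = points U.

Definition neighborhoods E : {set {set {vspace V}}} :=
  [set neighborhood E x | x in subspaces 1].

Definition automorphisms E : {set coset_of scalars} :=
  [set g in PGammaL | [forall e in edges E, PGammaL_action e g \in edges E]].

End Semilinear.

(* Main.v *)
Require Import Defs.
From mathcomp Require Import all_boot all_fingroup all_algebra all_solvable.
From mathcomp Require Import all_field.

(** Attach to the point [alpha g] the subspace [N (alpha g) = W g]; this is well
    defined because [Delta] is a union of [P]-orbits.  The hypothesis on [Delta]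
    says precisely that the relation [y <= N x] between points is symmetric.  Its
    edges are the lines [x + y] with [y <= N x], and [N] being subspace-valued and
    symmetric guarantees that no line creates an unwanted adjacency. *)

Local Open Scope group_scope.

Section SubspaceAction.
Set Implicit Arguments.
Unset Strict Implicit.
Variables (F : finFieldType) (v : nat).
Local Notation V := 'rV[F]_v.
Local Notation to := (PGammaL_action F v).
Implicit Types (U W x y : {vspace V}) (g : coset_of (scalars F v)).

Lemma pointP {x} : reflect (\dim x = 1%N) (x \in subspaces F v 1).
Proof. by rewrite inE; apply: eqP. Qed.

(** A semilinear map need not be linear over [F], so dimensions are compared by counting: [f] maps
    [U] bijectively onto its image, and the number of vectors determines the dimension. *)
Lemma dim_subspace_img f U :
  f \in GammaL F v -> \dim (subspace_img U f) = \dim U.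
Proof.
move=> fG; apply: (@expnI #|F|); first exact: finNzRing_gt1.
rewrite -!card_vspace -(card_imset (mem U) (@perm_inj _ f)).
apply: eq_card => u; rewrite -[u](permKV f) (mem_imset _ _ perm_inj).
exact: mem_subspace_img.
Qed.

Lemma subspace_imgD f U W : f \in GammaL F v ->
  subspace_img (U + W)%VS f
    = (subspace_img U f + subspace_img W f)%VS.
Proof.
move=> fG; have [_ [_ fD _]] := GammaLP _ fG.
apply/eqP; rewrite eqEsubv subv_add; apply/and3P; split; apply/subvP=> u;
  rewrite -[u](permKV f) !(mem_subspace_img _ _ fG) // => uU.
- have [w1 w1U [w2 w2W ->]] := memv_addP uU.
  by rewrite fD memv_add ?mem_subspace_img.
- exact: subvP (addvSl U W) _ uU.
- exact: subvP (addvSr U W) _ uU.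
Qed.

Lemma actD g U W : g \in PGammaL F v -> to (U + W)%VS g = (to U g + to W g)%VS.
Proof. by case/morphimP=> f _ fG ->; rewrite !PGammaL_actionE ?subspace_imgD. Qed.

Lemma dim_act g U : g \in PGammaL F v -> \dim (to U g) = \dim U.
Proof. by case/morphimP=> f _ fG ->; rewrite PGammaL_actionE ?dim_subspace_img. Qed.

Lemma act_subspaces g U k :
  g \in PGammaL F v -> (to U g \in subspaces F v k) = (U \in subspaces F v k).
Proof. by move=> gG; rewrite !inE dim_act. Qed.

(** Inclusion is the equation [U + W = W], and an injective action that commutes with sums preserves
    and reflects it. *)
Lemma act_subv g U W : g \in PGammaL F v -> (to U g <= to W g)%VS = (U <= W)%VS.
Proof.
move=> gG; rewrite !(sameP addv_idPr eqP) -actD //.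
by rewrite (inj_eq (act_inj to g)).
Qed.

Lemma setact_points g W :
  g \in PGammaL F v -> setact to (points W) g = points (to W g).
Proof.
move=> gG; apply/setP=> x; apply/imsetP/idP=> [[y] | ].
  by rewrite inE => /andP[yp yW] ->; rewrite inE act_subspaces ?act_subv ?yp.
have defx: x = to (to x g^-1) g by rewrite (actKVin to).
rewrite inE {1 2}defx act_subspaces // act_subv // => xW.
by exists (to x g^-1) => //; rewrite inE.
Qed.

(** Every nonzero vector of [U] spans a point of [U], so the points determine the subspace. *)
Lemma points_subset U W : (points U \subset points W) = (U <= W)%VS.
Proof.
apply/subsetP/idP=> [sUW | sUW x]; last first.
  by rewrite !inE => /andP[-> /subv_trans->].
apply/subvP=> u uU; have [->|u0] := eqVneq u 0%R; first exact: mem0v.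
suffices: <[u]>%VS \in points W by rewrite inE => /andP[_].
by apply: sUW; rewrite !inE dim_vline u0 -memvE.
Qed.

Lemma dim_add_points x y : x \in subspaces F v 1 -> y \in subspaces F v 1 ->
  x != y -> \dim (x + y) = 2.
Proof.
move=> /pointP dx /pointP dy xy; apply/anti_leq/andP; split.
  by have [] := dimv_add_leqif x y; rewrite dx dy.
(* If the sum had dimension at most 1, it would coincide with both [x] and [y]. *)
rewrite ltnNge; apply: contra xy => dxy.
have /eqP def_x : (x == x + y)%VS by rewrite eqEdim addvSl dx.
by rewrite eq_sym eqEdim dx dy andbT def_x addvSr.
Qed.

Lemma add_points_eq x y z : x \in subspaces F v 1 -> y \in subspaces F v 1 ->
    z \in subspaces F v 1 -> x != y -> x != z -> (y <= x + z)%VS ->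
  (x + y = x + z)%VS.
Proof.
move=> xp yp zp xy xz yxz; apply/eqP.
by rewrite eqEdim subv_add addvSl yxz !dim_add_points.
Qed.

Section GraphOfSpaces.
Variable N : {vspace V} -> {vspace V}.

Definition space_edges : {set {vspace V}} :=
  [set (x + y)%VS | x in subspaces F v 1,
                    y in [set y in points (N x) | x != y]].

Lemma space_edges_dim : space_edges \subset subspaces F v 2.
Proof.
apply/subsetP=> _ /imset2P[x y xp yN ->].
move: yN; rewrite 3!inE => /andP[/andP[yp _] xy].
by rewrite inE dim_add_points // inE.
Qed.

Definition space_graph := QGraph space_edges_dim.

Hypothesis N_refl : {in subspaces F v 1, forall x, (x <= N x)%VS}.
Hypothesis N_sym :
  {in subspaces F v 1 &, forall x y, (y <= N x)%VS -> (x <= N y)%VS}.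

(* If the line x + y also arises as x' + y' with y' in N x', then x lies in N x',
   so by symmetry N x contains x' and thus the whole line. *)
Lemma neighborhood_space_graph x : x \in subspaces F v 1 ->
  neighborhood space_graph x = points (N x).
Proof.
move=> xp; apply/setP=> y; rewrite [LHS]inE [RHS]inE.
case yp: (y \in subspaces F v 1) => //=.
have [->|yx] := eqVneq y x; first by rewrite N_refl.
rewrite /adjacent eq_sym yx /=.
apply/imset2P/idP=> [[x' y' x'p]|yN]; last first.
  by exists x y; rewrite // inE [y \in points _]inE yp yN eq_sym.
rewrite inE [y' \in points _]inE => /andP[/andP[y'p y'N] x'y'] exy.
have sN: (x + y <= N x')%VS by rewrite exy subv_add N_refl.
have [->|x'x] := eqVneq x x'; first exact: subv_trans (addvSr x y) sN.
have x'N: (x' <= N x)%VS by apply: N_sym => //; apply: subv_trans (addvSl x y) sN.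
apply: subv_trans (addvSr x y) _.
rewrite -(@add_points_eq x x' y) // 1?eq_sym // ?exy ?addvSl //.
by rewrite subv_add N_refl.
Qed.

End GraphOfSpaces.
End SubspaceAction.

Theorem theorem3 (F : finFieldType) (v : nat) (v_gt0 : (0 < v)%N)
    (G : {group coset_of (scalars F v)})
    (sGPGammaL : G \subset PGammaL F v)
    (transG : [transitive G, on subspaces F v 1 | PGammaL_action F v])
    (alpha : {vspace 'rV[F]_v}) (alpha_point : alpha \in subspaces F v 1)
    (P : {set coset_of (scalars F v)})
    (defP : P = 'C_G[alpha | PGammaL_action F v])
    (s : nat) (delta : 'I_s.+1 -> {vspace 'rV[F]_v})
    (delta_point : forall i, delta i \in subspaces F v 1)
    (delta_alpha : delta ord0 = alpha)
    (delta_distinct :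
       injective (fun i => orbit (PGammaL_action F v) P (delta i)))
    (Delta : {set {vspace 'rV[F]_v}})
    (defDelta : Delta = \bigcup_i orbit (PGammaL_action F v) P (delta i))
    (W : {vspace 'rV[F]_v}) (DeltaW : Delta = points W)
    (Delta_inv :
       [set PGammaL_action F v alpha g
         | g in G & PGammaL_action F v alpha g^-1 \in Delta] = Delta) :
  exists E : qgraph F v,
    [/\ regular E (\dim W).-1,
        [set setact (PGammaL_action F v) Delta g | g in G] = neighborhoods E,
        [set (PGammaL_action F v alpha g, setact (PGammaL_action F v) Delta g)
          | g in G]
        = [set (x, neighborhood E x) | x in subspaces F v 1],
        G \subset automorphisms E
      & [transitive G, on subspaces F v 1 | PGammaL_action F v]
        /\ [transitive G, on neighborhoods E | (PGammaL_action F v)^*]].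
Proof.
pose to := PGammaL_action F v.
have GP g : g \in G -> g \in PGammaL F v by apply: subsetP.
have tom x g h : g \in G -> h \in G -> to x (g * h) = to (to x g) h.
  by move=> gG hG; rewrite (actMin to) ?GP.
have toK x g : g \in G -> to (to x g) g^-1 = x.
  by move=> gG; rewrite (actKin to) ?GP.
have to_sub g U U' : g \in G -> (to U g <= to U' g)%VS = (U <= U')%VS.
  by move=> gG; rewrite act_subv ?GP.
have to_pt g : g \in G -> to alpha g \in subspaces F v 1.
  by move=> gG; rewrite act_subspaces ?GP.
have orbG x : x \in subspaces F v 1 -> exists2 g, g \in G & x = to alpha g.
  (* Transitivity only provides some base point [x0]; both [alpha] and [x] are reached from it. *)
  have /imsetP[x0 _ def1] := transG; have := alpha_point.
  rewrite def1 => /imsetP[h hG ->] /imsetP[g gG ->].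
  exists (h^-1 * g); first by rewrite groupM ?groupV.
  by rewrite -tom ?mulKVg ?groupM ?groupV.
(* Such a [p] lies in [P], so it maps each [P]-orbit in [Delta] into itself and [W] into [W]; equal
   dimensions give equality. *)
have W_fix p : p \in G -> to alpha p = alpha -> to W p = W.
  move=> pG ap; apply/eqP; rewrite eqEdim dim_act ?GP // leqnn andbT.
  rewrite -points_subset -setact_points ?GP // -DeltaW defDelta.
  apply/subsetP=> _ /imsetP[x /bigcupP[i _ /imsetP[h hP ->]] ->].
  apply/bigcupP; exists i => //; move: hP; rewrite defP => hP.
  have [hG _] := setIP hP.
  rewrite -tom //; apply: mem_orbit; rewrite groupM //.
  by rewrite !inE pG [p \in _]GP //= sub1set inE; apply/eqP.
(* [W_fix] applies to [g * h^-1], which fixes [alpha]. *)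
have W_coset g h :
    g \in G -> h \in G -> to alpha g = to alpha h -> to W g = to W h.
  move=> gG hG agh; rewrite -[g](mulgKV h) tom ?groupM ?groupV // W_fix //.
    by rewrite groupM ?groupV.
  by rewrite tom ?groupV // agh toK.
have alphaW: (alpha <= W)%VS.
  have : alpha \in Delta.
    rewrite defDelta; apply/bigcupP; exists ord0 => //.
    rewrite delta_alpha defP; apply/imsetP.
    by exists 1; [apply: group1 | rewrite (act1 to)].
  by rewrite DeltaW inE => /andP[].
(* Delta_inv supplies k' in P k with alpha k'^-1 in Delta. *)
have W_inv k : k \in G -> (to alpha k <= W)%VS -> (to alpha k^-1 <= W)%VS.
  move=> kG akW; have: to alpha k \in Delta by rewrite DeltaW inE to_pt.
  rewrite -Delta_inv => /imsetP[k' /setIdP[k'G]].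
  rewrite DeltaW inE -/to => /andP[_ ak'W] /esym akk'.
  (* Acting by [k] turns the goal into [alpha <= W k]. Since [W k = W k'], acting by [k'^-1] leaves
     [alpha k'^-1 <= W]. *)
  rewrite -(to_sub k) // -tom ?groupV // mulVg (act1 to).
  rewrite -(W_coset k' k) // -[alpha](@toK alpha k'^-1) ?groupV //.
  by rewrite invgK to_sub.
(* [repr] picks some element of [G] taking [alpha] to [x]; by [W_coset] the choice is immaterial. *)
pose N x := to W (repr (amove to G alpha x)).
have NE g : g \in G -> N (to alpha g) = to W g.
  move=> gG; have : g \in amove to G alpha (to alpha g) by rewrite inE gG /=.
  by move/mem_repr; rewrite inE => /andP[hG /eqP]; apply: W_coset.
have N_refl : {in subspaces F v 1, forall x, (x <= N x)%VS}.
  by move=> _ /orbG[g gG ->]; rewrite NE ?to_sub.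
have N_sym :
    {in subspaces F v 1 &, forall x y, (y <= N x)%VS -> (x <= N y)%VS}.
  move=> _ _ /orbG[g gG ->] /orbG[h hG ->]; rewrite !NE // => hW.
  (* With [x = alpha g] and [y = alpha h], the hypothesis reads [alpha k <= W] and the goal
     [alpha k^-1 <= W] for [k = h * g^-1], so [W_inv] applies. *)
  rewrite -(to_sub h^-1) ?groupV // toK // -tom ?groupV //.
  rewrite -[g * _]invgK invMg invgK W_inv ?groupM ?groupV //.
  by rewrite tom ?groupV // -(to_sub g) // -tom ?groupV // mulVg (act1 to).
have nbhd g : g \in G ->
    neighborhood (space_graph N) (to alpha g) = setact to Delta g.
  move=> gG; rewrite neighborhood_space_graph ?to_pt // NE //.
  by rewrite DeltaW setact_points ?GP.
have defB : [set setact to Delta g | g in G]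
              = neighborhoods (space_graph N).
  apply/setP=> B; apply/imsetP/imsetP=> [[g gG ->]|[_ /orbG[g gG ->] ->]].
    by exists (to alpha g); rewrite ?to_pt ?nbhd.
  by exists g; rewrite ?nbhd.
exists (space_graph N); split=> //.
- move=> _ /orbG[g gG ->]; exists (to W g).
    (* The predecessor is a true one: [W] contains the point [alpha], so its dimension is
       positive. *)
    rewrite dim_act ?GP // prednK //.
    by apply: leq_trans (dimvS alphaW); rewrite (pointP alpha_point).
  by rewrite nbhd // DeltaW setact_points ?GP.
- apply/setP=> B; apply/imsetP/imsetP=> [[g gG ->]|[_ /orbG[g gG ->] ->]].
    by exists (to alpha g); rewrite ?to_pt ?nbhd.
  by exists g; rewrite ?nbhd.
(* [N] commutes with [G]: for [x = alpha h], [N (x g) = W (h * g) = (N x) g]. So the edge [x + y]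
   goes to the edge [x g + y g]. *)
- apply/subsetP=> g gG; rewrite inE GP //=; apply/forall_inP.
  move=> _ /imset2P[_ y /orbG[h hG ->] yN ->].
  move: yN; rewrite inE [y \in points _]inE NE // => /andP[/andP[yp yW] hy].
  rewrite actD ?GP //; apply: imset2_f; first by rewrite -tom // to_pt ?groupM.
  rewrite inE [to y g \in _]inE act_subspaces ?GP // yp.
  rewrite (inj_eq (act_inj to g)) hy.
  by rewrite -tom // NE ?groupM // tom // to_sub ?yW.
(* By [defB] the neighborhoods form the [G]-orbit of [Delta]. *)
- split=> //; rewrite -defB; apply/imsetP; exists Delta => //.
  by apply/imsetP; exists 1; rewrite ?group1 // (act1 (to^*)).
Qed.
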